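(* Let $m,n,s,k$ be four integers such that $3\leq s\leq n$, $3\leq k\leq m$ and $ms=nk$. Set $d=\gcd(s,k)$. There exists an integer Heffter array $\mathrm{H}(m,n;s,k)$ in each of the following cases: (1) $d\equiv 0 \pmod 4$; (2) $d\equiv 1\pmod 4$ with $d\geq 5$ and $nk\equiv 3\pmod 4$; (3) $d\equiv 2\pmod 4$ and $nk\equiv 0\pmod 4$; (4) $d\equiv 3\pmod 4$ and $nk\equiv 0,3\pmod 4$.
   Context: A partially filled (pf) array is a matrix some of whose cells may be empty; row and column sums are taken over the filled cells. An integer Heffter array $\mathrm{H}(m,n;s,k)$ is an $m\times n$ pf array with entries in $\{\pm1,\pm2,\ldots,\pm nk\}\subset\mathbb{Z}$ such that: (a) each row contains exactly $s$ filled cells and each column contains exactly $k$ filled cells; (b) no two entries agree in absolute value; (c) the elements in every row and in every column sum to $0$ in $\mathbb{Z}$. *)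

(* Defs.v *)
From mathcomp Require Import all_boot all_order all_algebra.

Set Implicit Arguments.
Unset Strict Implicit.
Unset Printing Implicit Defensive.

Import GRing.Theory.

(* [None] is an empty cell. *)
Definition pf_array (m n : nat) : Type := 'M[option int]_(m, n).

Definition filled m n (A : pf_array m n) (i : 'I_m) (j : 'I_n) : bool :=
  isSome (A i j).

Definition row_sum m n (A : pf_array m n) (i : 'I_m) : int :=
  (\sum_(j | filled A i j) odflt 0 (A i j))%R.

Definition col_sum m n (A : pf_array m n) (j : 'I_n) : int :=
  (\sum_(i | filled A i j) odflt 0 (A i j))%R.

Record integer_heffter (m n s k : nat) (A : pf_array m n) : Prop :=
  IntegerHeffter {
    heffter_entries : forall i j x, A i j = Some x -> 1 <= `|x| <= n * k;
    heffter_row_card : forall i, #|[set j | filled A i j]| = s;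
    heffter_col_card : forall j, #|[set i | filled A i j]| = k;
    heffter_abs_inj : forall i j i' j' x y,
      A i j = Some x -> A i' j' = Some y -> `|x| = `|y| ->
      (i, j) = (i', j');
    heffter_row_sum : forall i, row_sum A i = 0%R;
    heffter_col_sum : forall j, col_sum A j = 0%R
  }.

(* Main.v *)
(** Write [s = d b], [k = d a], [m = c a], [n = c b] with [a], [b] coprime, [d <= c], and put
    [N = c a b]. A square array of order [N] whose filled cells are [d] consecutive cyclic
    diagonals can be folded into an [m x n] array by reducing row indices modulo [m] and
    column indices modulo [n]; no two cells collide, and zero sums remain zero sums.
    For [d <> 2 (mod 4)] the square array consists of a core of 0, 3 or 5 diagonals and of
    groups of four diagonals with balanced signs, which can be added for every [N]. In
    the cores, opposite diagonals carry numbers with a constant difference, so that row and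
    column sums vanish together and only a zigzag sequence, as in the graceful labelling of a
    path, has to be found.
    For [d = 2 (mod 4)] the array is made of pairs of rows (strips) of [2 x 2] blocks, with
    consecutive magnitudes and balanced signs; every strip has zero row sums, and the strips
    are arranged so that the column sums cancel. *)

Require Import Defs.
From mathcomp Require Import all_boot all_order all_algebra.
From mathcomp Require Import zify ring.

Set Implicit Arguments.
Unset Strict Implicit.
Unset Printing Implicit Defensive.

Import GRing.Theory Num.Theory.

(** * Folding *)

(** By the cardinality hypothesis [(r, g)] is a bijection, so [g] maps every fibre of [r]
    bijectively onto [G]. *)
Lemma card_fiber_coord (L G : finType) (m : nat) (r : L -> 'I_m) (g : L -> G) (i : 'I_m) :
  injective (fun l => (r l, g l)) -> #|L| = m * #|G| ->
  #|[set l | r l == i]| = #|G|.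
Proof.
move=> inj cardL.
have bij : bijective (fun l => (r l, g l)).
  by apply: inj_card_bij => //; rewrite cardL card_prod card_ord.
rewrite -(card_in_imset (f := g)) => [|l l']; last first.
  by rewrite !inE => /eqP ri /eqP ri' eg; apply: inj; rewrite /= ri ri' eg.
rewrite -cardsT; congr #|pred_of_set _|; apply/setP => x; rewrite inE.
case: bij => f' _ fK; apply/imsetP; exists (f' (i, x)).
  by rewrite inE; have := fK (i, x) => /= -[-> _].
by have := fK (i, x) => /= -[_ ->].
Qed.

(** [L] indexes the filled cells. The tags [g] and [h] separate the cells within one row and within
    one column; together with the cardinality assumptions they replace counting. *)
Lemma heffter_of_labels (L G H : finType) (m n s k : nat)
    (r : L -> 'I_m) (c : L -> 'I_n) (v : L -> int) (g : L -> G) (h : L -> H) :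
  #|G| = s -> #|H| = k -> #|L| = n * k -> m * s = n * k ->
  injective (fun l => (r l, g l)) -> injective (fun l => (c l, h l)) ->
  injective (fun l => (r l, c l)) -> injective (fun l => `|v l|%N) ->
  (forall l, 1 <= `|v l| <= n * k) ->
  (forall i, (\sum_(l | r l == i) v l = 0)%R) ->
  (forall j, (\sum_(l | c l == j) v l = 0)%R) ->
  exists A : pf_array m n, integer_heffter s k A.
Proof.
move=> cardG cardH cardL ms injr injc injrc injv rng rows cols.
pose pk i j := [pick l | (r l == i) && (c l == j)].
have pkE l : pk (r l) (c l) = Some l.
  rewrite /pk; case: pickP => [l' /andP[/eqP e1 /eqP e2]|/(_ l)]; last by rewrite !eqxx.
  by congr Some; apply: injrc; rewrite e1 e2.
have pkP i j l : pk i j = Some l -> r l = i /\ c l = j.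
  by rewrite /pk; case: pickP => // l' /andP[/eqP e1 /eqP e2] [<-].
exists (\matrix_(i, j) omap v (pk i j))%R.
have fillE i j : filled (\matrix_(i, j) omap v (pk i j))%R i j = isSome (pk i j).
  by rewrite /filled mxE; case: (pk i j).
have AE i j x : (\matrix_(i, j) omap v (pk i j))%R i j = Some x ->
    exists2 l, pk i j = Some l & x = v l.
  by rewrite mxE; case: (pk i j) => //= l [<-]; exists l.
have rowS i : [set j | isSome (pk i j)] = c @: [set l | r l == i].
  apply/setP => j; rewrite inE; apply/idP/imsetP => [|[l]].
    by case E: (pk i j) => [l|//] _; case: (pkP _ _ _ E) => <- <-; exists l; rewrite ?inE.
  by rewrite inE => /eqP <- ->; rewrite pkE.
have colS j : [set i | isSome (pk i j)] = r @: [set l | c l == j].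
  apply/setP => i; rewrite inE; apply/idP/imsetP => [|[l]].
    by case E: (pk i j) => [l|//] _; case: (pkP _ _ _ E) => <- <-; exists l; rewrite ?inE.
  by rewrite inE => /eqP <- ->; rewrite pkE.
have injrow i : {in [set l | r l == i] &, injective c}.
  by move=> l l'; rewrite !inE => /eqP e /eqP e' ec; apply: injrc; rewrite e e' ec.
have injcol j : {in [set l | c l == j] &, injective r}.
  by move=> l l'; rewrite !inE => /eqP e /eqP e' er; apply: injrc; rewrite e e' er.
split.
- by move=> i j x /AE[l _ ->]; exact: rng.
- move=> i; rewrite -cardG -(card_fiber_coord i injr) ?cardL ?cardG //.
  rewrite -(card_in_imset (injrow i)) -rowS.
  by congr #|pred_of_set _|; apply/setP => j; rewrite !inE fillE.
- move=> j; rewrite -cardH -(card_fiber_coord j injc) ?cardL ?cardH //.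
  rewrite -(card_in_imset (injcol j)) -colS.
  by congr #|pred_of_set _|; apply/setP => i; rewrite !inE fillE.
- move=> i j i' j' x y /AE[l pl ->] /AE[l' pl' ->] /injv ell.
  by case: (pkP _ _ _ pl) => <- <-; case: (pkP _ _ _ pl') => <- <-; rewrite ell.
- move=> i; rewrite /row_sum (eq_bigl (fun j => j \in [set j | isSome (pk i j)])) => [|j];
    last by rewrite inE fillE.
  rewrite rowS big_imset /=; last exact: injrow.
  rewrite -[RHS](rows i); apply: eq_big => l; first by rewrite inE.
  by rewrite inE => /eqP <-; rewrite mxE pkE.
- move=> j; rewrite /col_sum (eq_bigl (fun i => i \in [set i | isSome (pk i j)])) => [|i];
    last by rewrite inE fillE.
  rewrite colS big_imset /=; last exact: injcol.
  rewrite -[RHS](cols j); apply: eq_big => l; first by rewrite inE.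
  by rewrite inE => /eqP <-; rewrite mxE pkE.
Qed.

Lemma heffter_transpose (m n s k : nat) (A : pf_array m n) :
  m * s = n * k -> integer_heffter s k A -> integer_heffter k s (A^T)%R.
Proof.
move=> ms [ent rc cc inj rs cs].
split.
- by move=> i j x; rewrite mxE ms; apply: ent.
- by move=> j; rewrite -(cc j); congr #|pred_of_set _|; apply/setP => i; rewrite !inE /filled mxE.
- by move=> i; rewrite -(rc i); congr #|pred_of_set _|; apply/setP => j; rewrite !inE /filled mxE.
- move=> i j i' j' x y; rewrite !mxE => e e' exy.
  by case: (inj _ _ _ _ _ _ e e' exy) => -> ->.
- move=> j; rewrite -[RHS](cs j) /row_sum /col_sum; apply: eq_big => i; last by rewrite mxE.
  by rewrite /filled mxE.
- move=> i; rewrite -[RHS](rs i) /row_sum /col_sum; apply: eq_big => j; last by rewrite mxE.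
  by rewrite /filled mxE.
Qed.

(** Arithmetic modulo [N] by conditionals rather than [%%], so that case analysis leaves linear
    goals for [lia]. *)
Definition cyc_add (N i t : nat) : nat := if i + t < N then i + t else i + t - N.
Definition cyc_sub (N j t : nat) : nat := if t <= j then j - t else j + N - t.

Lemma cyc_add_lt N i t : i < N -> t <= N -> cyc_add N i t < N.
Proof. by move=> iN tN; rewrite /cyc_add; case: ifP => ?; lia. Qed.

Lemma cyc_sub_lt N i t : i < N -> t <= N -> cyc_sub N i t < N.
Proof. by move=> iN tN; rewrite /cyc_sub; case: ifP => ?; lia. Qed.

Lemma cyc_add_inj N t i j : i < N -> j < N -> cyc_add N i t = cyc_add N j t -> i = j.
Proof. by move=> iN jN; rewrite /cyc_add; case: ifP => ?; case: ifP => ?; lia. Qed.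

Ltac cyc_lia :=
  rewrite ?/cyc_sub; repeat (case: ifP => ?); rewrite ?/cyc_add; repeat (case: ifP => ?); lia.

(** [f t i] is the entry in row [i] and column [i + t] modulo [N], so column [j] meets diagonal [t]
    in row [j - t]. *)
Record cyclic_heffter (N d : nat) (f : nat -> nat -> int) : Prop := CyclicHeffter {
  cyclic_range : forall t i, t < d -> i < N -> 1 <= `|f t i| <= N * d;
  cyclic_abs_inj : forall t i t' i', t < d -> i < N -> t' < d -> i' < N ->
    `|f t i|%N = `|f t' i'|%N -> t = t' /\ i = i';
  cyclic_row_sum : forall i, i < N -> (\sum_(t < d) f t i = 0)%R;
  cyclic_col_sum : forall j, j < N -> (\sum_(t < d) f t (cyc_sub N j t) = 0)%R
}.

(** The difference is [c * z] with [a] and [b], hence [a * b], dividing [z < a * b]. *)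
Lemma eq_mod_coprime_mul (a b c x y : nat) :
  coprime a b -> x < c * a * b -> y < c * a * b ->
  x = y %[mod c * a] -> x = y %[mod c * b] -> x = y.
Proof.
move=> cop; wlog le_yx : x y / y <= x => [hw ltx lty ea eb|].
  by case: (leqP y x) => [/hw|/ltnW/hw h]; [exact | apply/esym/h].
move=> ltx lty /eqP; rewrite eqn_mod_dvd // => da /eqP; rewrite eqn_mod_dvd // => db.
have c_gt0 : 0 < c by case: (c) ltx.
have /dvdnP[z zE] : c %| x - y by apply: dvdn_trans da; apply: dvdn_mulr.
move: da db; rewrite zE ![c * _]mulnC !dvdn_pmul2r // => da db.
have : a * b %| z by rewrite Gauss_dvd // da.
have z_lt : z < a * b by rewrite -(ltn_pmul2r c_gt0) -zE; lia.
case: (posnP z) => [z0 _|z_gt0 /(dvdn_leq z_gt0)]; last by rewrite leqNgt z_lt.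
by move: zE; rewrite z0; lia.
Qed.

Lemma eq_mod_small (c x y : nat) : x < c -> y < c -> x = y %[mod c] -> x = y.
Proof. by move=> xc yc; rewrite !modn_small. Qed.

Lemma cyc_add_mod (N n i t : nat) : n %| N -> t <= N -> i < N ->
  cyc_add N i t = i + t %[mod n].
Proof.
move=> /dvdnP[q ->] tN iN; rewrite /cyc_add; case: ltnP => // le.
by rewrite -[in RHS](subnK le) -modnDmr modnMl addn0.
Qed.

Lemma eq_divn_modn (n x y : nat) : x %/ n = y %/ n -> x = y %[mod n] -> x = y.
Proof. by move=> e1 e2; rewrite (divn_eq x n) (divn_eq y n) e1 e2. Qed.

(* The cell [(i, i + t)] of the square array is placed at [(i mod m, i + t mod n)]:
   since [n k = N d], the rows and the columns of the square are merged into those of the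
   rectangle, and no two cells collide because the diagonals are distinct modulo [c]. *)
Lemma heffter_of_cyclic (c a b d : nat) (f : nat -> nat -> int) :
  coprime a b -> 0 < a -> 0 < b -> 0 < d <= c ->
  cyclic_heffter (c * a * b) d f ->
  exists A : pf_array (c * a) (c * b), integer_heffter (d * b) (d * a) A.
Proof.
move=> cop a0 b0 /andP[d0 dc] [rng inj rows cols].
set N := c * a * b in rng inj rows cols.
have c0 : 0 < c by lia.
have m0 : 0 < c * a by rewrite muln_gt0 c0.
have n0 : 0 < c * b by rewrite muln_gt0 c0.
have dN : d <= N by rewrite (leq_trans dc) // /N -mulnA leq_pmulr // muln_gt0 a0.
have nN : c * b %| N by rewrite /N mulnAC dvdn_mulr.
have addN i t : i < N -> t < d -> cyc_add N i t < N.
  by move=> iN /ltnW td; apply: cyc_add_lt => //; apply: leq_trans dN.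
have NE1 : N = b * (c * a) by rewrite /N mulnC.
have NE2 : N = a * (c * b) by rewrite /N; lia.
have rP (l : 'I_N * 'I_d) : l.1 %% (c * a) < c * a by rewrite ltn_mod.
have cP (l : 'I_N * 'I_d) : cyc_add N l.1 l.2 %% (c * b) < c * b by rewrite ltn_mod.
have gP (l : 'I_N * 'I_d) : l.1 %/ (c * a) < b by rewrite ltn_divLR // -NE1.
have hP (l : 'I_N * 'I_d) : cyc_add N l.1 l.2 %/ (c * b) < a.
  by rewrite ltn_divLR // -NE2 addN.
pose pos l : 'I_(c * a) := Ordinal (rP l).
pose col l : 'I_(c * b) := Ordinal (cP l).
pose g (l : 'I_N * 'I_d) := (l.2, Ordinal (gP l)).
pose h (l : 'I_N * 'I_d) := (l.2, Ordinal (hP l)).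
have subN j t : j < N -> t < d -> cyc_sub N j t < N.
  by move=> jN /ltnW td; apply: cyc_sub_lt => //; apply: leq_trans dN.
apply: (@heffter_of_labels _ _ _ _ _ _ _ pos col (fun l => f l.2 l.1) g h).
- by rewrite card_prod !card_ord.
- by rewrite card_prod !card_ord.
- by rewrite card_prod !card_ord NE2; lia.
- by lia.
- move=> [i t] [i' t'] /= [] e1 -> e2; congr (_, _); apply/val_inj.
  exact: eq_divn_modn e2 e1.
- move=> [i t] [i' t'] /= [] e1 e2 e3; rewrite -e2 in e1 e3 *; congr (_, _); apply/val_inj.
  exact: cyc_add_inj (ltn_ord _) (ltn_ord _) (eq_divn_modn e3 e1).
- move=> [i t] [i' t'] /= [] e1 e2.
  move: e2; rewrite !cyc_add_mod ?(leq_trans (ltnW (ltn_ord _))) // => e2.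
  (* Both congruences hold modulo [c]; subtracting them gives [t = t'] modulo [c], and
     [t, t' < d <= c]. *)
  have et : t = t'.
    apply/val_inj; apply: (@eq_mod_small c) => /=; [exact: leq_trans dc | exact: leq_trans dc |].
    have E1 : i = i' %[mod c].
      by rewrite -(modn_dvdm i (dvdn_mulr a (dvdnn c))) e1 modn_dvdm ?dvdn_mulr.
    have E2 : i + t = i' + t' %[mod c].
      by rewrite -(modn_dvdm (i + t) (dvdn_mulr b (dvdnn c))) e2 modn_dvdm ?dvdn_mulr.
    by apply/eqP; rewrite -(eqn_modDl i) E2 -modnDml -E1 modnDml.
  rewrite -et in e2 *; congr (_, _); apply/val_inj.
  apply: (eq_mod_coprime_mul cop (ltn_ord _) (ltn_ord _) e1).
  by apply/eqP; rewrite -(eqn_modDr t); apply/eqP.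
- move=> [i t] [i' t'] /= e.
  have [e1 e2] := inj _ _ _ _ (ltn_ord t) (ltn_ord i) (ltn_ord t') (ltn_ord i') e.
  by congr (_, _); apply/val_inj.
- move=> [i t] /=; have -> : c * b * (d * a) = N * d by rewrite /N; lia.
  exact: rng.
- move=> r; transitivity (\sum_(i < N | pos (i, Ordinal d0) == r) \sum_(t < d) f t i)%R.
    by rewrite pair_big_dep; apply: eq_bigl => -[i t]; rewrite andbT.
  by apply: big1 => i _; apply: rows.
- move=> j; transitivity (\sum_(t < d) \sum_(i < N | col (i, t) == j) f t i)%R.
    by rewrite (exchange_big_dep xpredT) //= pair_big_dep; apply: eq_bigl => -[i t].
  (* Column [j] of the rectangle is the union of the columns [x] of the square in its residue class;
     on diagonal [t], column [x] is met in row [x - t]. *)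
  pose cl (x : 'I_N) := x %% (c * b) == j.
  rewrite (eq_bigr (fun t : 'I_d => \sum_(x < N | cl x) f t (cyc_sub N x t))%R) => [|t _].
    by rewrite exchange_big /= big1 // => x _; apply: cols.
  rewrite (reindex_onto (fun x : 'I_N => Ordinal (subN _ _ (ltn_ord x) (ltn_ord t)))
    (fun i : 'I_N => Ordinal (addN _ _ (ltn_ord i) (ltn_ord t)))) /= => [|i _]; last first.
    apply/val_inj; rewrite /=; have := ltn_ord i; have := ltn_ord t.
    by rewrite /cyc_add; case: ifP => ?; rewrite /cyc_sub; case: ifP => ?; lia.
  apply: eq_bigl => x.
  have E : cyc_add N (cyc_sub N x t) t = x.
    have := ltn_ord x; have := ltn_ord t.
    by rewrite /cyc_sub; case: ifP => ?; rewrite /cyc_add; case: ifP => ?; lia.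
  have -> : Ordinal (addN _ _ (ltn_ord (Ordinal (subN _ _ (ltn_ord x) (ltn_ord t)))) (ltn_ord t))
      = x by exact: val_inj.
  by rewrite eqxx andbT -val_eqE /= E.
Qed.

(** * Cyclically diagonal square arrays *)

Lemma cyclic_heffter0 (N : nat) (f : nat -> nat -> int) : cyclic_heffter N 0 f.
Proof. by split=> // *; rewrite big_ord0. Qed.

(** In each row the first two diagonals sum to -1 and the last two to 1. The shift by 2 pairs, in
    each column, the first with the third and the second with the fourth, with sums [-2N] and
    [2N]. *)
Definition four_diagonals (N o t i : nat) : int :=
  match t with
  | 0 => Posz (o + 2 * i + 1)
  | 1 => (- Posz (o + 2 * i + 2))%R
  | 2 => (- Posz (o + 2 * N + 2 * cyc_add N i 2 + 1))%R
  | _ => Posz (o + 2 * N + 2 * cyc_add N i 2 + 2)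
  end.

Lemma cyclic_heffter_add4 (N d : nat) (f : nat -> nat -> int) :
  d + 4 <= N -> cyclic_heffter N d f -> exists g, cyclic_heffter N (d + 4) g.
Proof.
move=> dN [rng inj rows cols].
pose o := N * d.
exists (fun t i => if t < d then f t i else four_diagonals N o (t - d) i).
have oE : N * (d + 4) = o + 4 * N by rewrite /o; lia.
have big t i : d <= t < d + 4 -> i < N ->
    o + 1 <= `|four_diagonals N o (t - d) i| <= o + 4 * N.
  move=> td iN; have : t - d < 4 by lia.
  by case: (t - d) => [|[|[|[|r]]]] //= _; cyc_lia.
have small t i : t < d -> i < N -> `|f t i| <= o.
  by move=> td iN; rewrite /o; case/andP: (rng _ _ td iN).
split.
- move=> t i td iN; rewrite oE; case: ifP => tlt.
    by have := rng _ _ tlt iN; rewrite -/o; lia.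
  by have := @big t i _ iN; lia.
- move=> t i t' i' td iN td' iN'.
  case: ifP => tlt; case: ifP => tlt'; first exact: inj.
  + by have := small _ _ tlt iN; have := @big t' i' _ iN'; lia.
  + by have := small _ _ tlt' iN'; have := @big t i _ iN; lia.
  move=> E; suff : t - d = t' - d /\ i = i' by lia.
  have : t - d < 4 by lia.
  have : t' - d < 4 by lia.
  move: E; case: (t - d) => [|[|[|[|r]]]] //=; case: (t' - d) => [|[|[|[|r']]]] //=;
  by cyc_lia.
- move=> i iN; rewrite addn4 !big_ord_recr /=.
  rewrite (eq_bigr (fun t : 'I_d => f t i)) => [|t _]; last by rewrite ltn_ord.
  rewrite rows // !ltnNge leqnn !leqW //= subnn.
  have -> : d.+1 - d = 1 by lia.
  have -> : d.+2 - d = 2 by lia.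
  have -> : d.+3 - d = 3 by lia.
  by rewrite /=; cyc_lia.
- move=> j jN; rewrite addn4 !big_ord_recr /=.
  rewrite (eq_bigr (fun t : 'I_d => f t (cyc_sub N j t))) => [|t _]; last by rewrite ltn_ord.
  rewrite cols // !ltnNge leqnn !leqW //= subnn.
  have -> : d.+1 - d = 1 by lia.
  have -> : d.+2 - d = 2 by lia.
  have -> : d.+3 - d = 3 by lia.
  by rewrite /four_diagonals; cyc_lia.
Qed.

Lemma cyclic_heffter_extend (N d e : nat) (f : nat -> nat -> int) :
  e <= N -> d <= e -> d = e %[mod 4] -> cyclic_heffter N d f ->
  exists g, cyclic_heffter N e g.
Proof.
move=> eN de /eqP E F; move: E; rewrite eq_sym eqn_mod_dvd // => /dvdnP[q eq].
have {eq} : e = d + q * 4 by lia.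
elim: q e eN {de} => [|q IH] e eN eE; first by exists f; rewrite eE addn0.
have [||g G] := IH (d + q * 4) => //; first by lia.
have [|h H] := cyclic_heffter_add4 _ G; first by lia.
by exists h; have -> : e = d + q * 4 + 4 by lia.
Qed.

(** * Cores of three and five diagonals *)

(* [w] takes exactly one value in each pair [{x, 1 - x}] with [1 <= x <= N]; this makes
   [2N + w] and [2N + 1 - w] together run through [N + 1 .. 3N]. *)
Record pair_transversal (N : nat) (w : nat -> int) : Prop := PairTransversal {
  transversal_range : forall i, i < N -> (- (N : int) < w i <= N)%R;
  transversal_inj : forall i j, i < N -> j < N -> w i = w j -> i = j;
  transversal_neq : forall i j, i < N -> j < N -> (w i + w j)%R <> 1%R
}.

(** The middle diagonal is forced by the row sums, and column [j] then cancels in the same way,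
    through [w] at [j - 1] and [j - 2]. The outer diagonals use up the magnitudes [N + 1 .. 3N], so
    the middle one has to take [1 .. N]. *)
Lemma cyclic_heffter3_of (N : nat) (w : nat -> int) (dl : nat -> nat) :
  3 <= N -> pair_transversal N w ->
  (forall i, i < N -> `|(1 - w i - w (cyc_sub N i 1))%R| = dl i) ->
  (forall i, i < N -> 1 <= dl i <= N) ->
  (forall i j, i < N -> j < N -> dl i = dl j -> i = j) ->
  cyclic_heffter N 3 (fun t i => match t with
    | 0 => w (cyc_sub N i 1) - (2 * N + 1)%N%:Z
    | 1 => 1 - w i - w (cyc_sub N i 1)
    | _ => w i + (2 * N)%N%:Z
    end%R).
Proof.
move=> N3 [wr wi wn] dlE dr di.
have pr i : i < N -> cyc_sub N i 1 < N by rewrite /cyc_sub; case: ifP; lia.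
have pi i j : i < N -> j < N -> cyc_sub N i 1 = cyc_sub N j 1 -> i = j.
  by rewrite /cyc_sub; case: ifP => ?; case: ifP; lia.
split.
- move=> [|[|[|t]]] i // _ iN; have := wr _ iN; have := wr _ (pr _ iN).
  + by lia.
  + by rewrite dlE //; have := dr _ iN; lia.
  + by lia.
- move=> t i t' j tlt iN tlt' jN.
  have p1 := pr _ iN; have q1 := pr _ jN.
  move: (wr _ iN) (wr _ jN) (wr _ p1) (wr _ q1) (dr _ iN) (dr _ jN) (dlE _ iN) (dlE _ jN).
  move: t t' tlt tlt' => [|[|[|t]]] [|[|[|t']]] //= _ _ ???????? E; try lia.
  + by split=> //; apply: pi => //; apply: wi => //; lia.
  + by case: (wn _ _ p1 jN); lia.
  + by split=> //; apply: di => //; lia.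
  + by case: (wn _ _ iN q1); lia.
  + by split=> //; apply: wi => //; lia.
- by move=> i iN; rewrite !big_ord_recr big_ord0 /=; lia.
- move=> j jN; rewrite !big_ord_recr big_ord0 /=.
  have -> : cyc_sub N j 0 = j by rewrite /cyc_sub /= subn0.
  have -> : cyc_sub N (cyc_sub N j 1) 1 = cyc_sub N j 2.
    by rewrite /cyc_sub; case: (ltnP 0 j) => ?; case: ifP => ?; case: ifP => ?; lia.
  by lia.
Qed.

(** As with three diagonals; the extra pair built from [v] takes the magnitudes [3N + 1 .. 5N]. *)
Lemma cyclic_heffter5_of (N : nat) (w v : nat -> int) (dl : nat -> nat) :
  5 <= N -> pair_transversal N w -> pair_transversal N v ->
  (forall i, i < N ->
    `|(2 - w i - w (cyc_sub N i 2) - v i - v (cyc_sub N i 1))%R| = dl i) ->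
  (forall i, i < N -> 1 <= dl i <= N) ->
  (forall i j, i < N -> j < N -> dl i = dl j -> i = j) ->
  cyclic_heffter N 5 (fun t i => match t with
    | 0 => w (cyc_sub N i 2) - (2 * N + 1)%N%:Z
    | 1 => v (cyc_sub N i 1) - (4 * N + 1)%N%:Z
    | 2 => 2 - w i - w (cyc_sub N i 2) - v i - v (cyc_sub N i 1)
    | 3 => v i + (4 * N)%N%:Z
    | _ => w i + (2 * N)%N%:Z
    end%R).
Proof.
move=> N5 [wr wi wn] [vr vi vn] dlE dr di.
have pr t i : t <= 5 -> i < N -> cyc_sub N i t < N by rewrite /cyc_sub; case: ifP; lia.
have pi t i j : t <= 5 -> i < N -> j < N -> cyc_sub N i t = cyc_sub N j t -> i = j.
  by rewrite /cyc_sub; case: ifP => ?; case: ifP; lia.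
split.
- move=> [|[|[|[|[|t]]]]] i // _ iN; have p1 := @pr 1 _ isT iN; have p2 := @pr 2 _ isT iN.
  + by have := wr _ p2; lia.
  + by have := vr _ p1; lia.
  + by rewrite dlE //; have := dr _ iN; lia.
  + by have := vr _ iN; lia.
  + by have := wr _ iN; lia.
- move=> t i t' j tlt iN tlt' jN.
  have p1 := @pr 1 _ isT iN; have p2 := @pr 2 _ isT iN.
  have q1 := @pr 1 _ isT jN; have q2 := @pr 2 _ isT jN.
  move: (wr _ iN) (wr _ jN) (wr _ p2) (wr _ q2) (vr _ iN) (vr _ jN) (vr _ p1) (vr _ q1).
  move: (dr _ iN) (dr _ jN) (dlE _ iN) (dlE _ jN).
  move: t t' tlt tlt' => [|[|[|[|[|t]]]]] [|[|[|[|[|t']]]]] //= _ _ ???????????? E; try lia.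
  + by split=> //; apply: (@pi 2) => //; apply: wi => //; lia.
  + by case: (wn _ _ p2 jN); lia.
  + by split=> //; apply: (@pi 1) => //; apply: vi => //; lia.
  + by case: (vn _ _ p1 jN); lia.
  + by split=> //; apply: di => //; lia.
  + by case: (vn _ _ iN q1); lia.
  + by split=> //; apply: vi => //; lia.
  + by case: (wn _ _ iN q2); lia.
  + by split=> //; apply: wi => //; lia.
- by move=> i iN; rewrite !big_ord_recr big_ord0 /=; lia.
- move=> j jN; rewrite !big_ord_recr big_ord0 /=.
  have addS s t : s + t <= 5 -> cyc_sub N (cyc_sub N j s) t = cyc_sub N j (s + t).
    by move=> st; rewrite [cyc_sub N j s]/cyc_sub; case: ifP => ?; rewrite /cyc_sub;
       case: ifP => ?; case: ifP => ?; lia.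
  have -> : cyc_sub N j 0 = j by rewrite /cyc_sub /= subn0.
  rewrite (addS 1 1 isT : _ = cyc_sub N j 2) (addS 2 2 isT : _ = cyc_sub N j 4).
  by rewrite (addS 2 1 isT : _ = cyc_sub N j 3); lia.
Qed.

Definition zigzag (N i : nat) : nat := if odd i then N - i./2 else i./2.+1.

(** For values [w], [w'] swung from [a], [a'], the number [1 - w - w'] has magnitude [|a - a'|] if
    the choices differ and [a + a' - 1] if they agree. *)
Definition swing (b : bool) (a : nat) : int := if b then a%:Z%R else (1 - a%:Z)%R.

Lemma zigzag_range (N i : nat) : i < N -> 1 <= zigzag N i <= N.
Proof. by rewrite /zigzag; case: ifP; lia. Qed.

Lemma zigzag_inj (N i j : nat) : i < N -> j < N -> zigzag N i = zigzag N j -> i = j.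
Proof. by rewrite /zigzag; case: ifP => ?; case: ifP; lia. Qed.

Lemma swing_transversal (N : nat) (b : nat -> bool) (a : nat -> nat) :
  (forall i, i < N -> 1 <= a i <= N) ->
  (forall i j, i < N -> j < N -> a i = a j -> i = j) ->
  pair_transversal N (fun i => swing (b i) (a i)).
Proof.
move=> ar ai; split.
- by move=> i /ar; rewrite /swing; case: (b i); lia.
- move=> i j iN jN E; apply: ai => //; move: E (ar _ iN) (ar _ jN).
  by rewrite /swing; case: (b i); case: (b j); lia.
- move=> i j iN jN; have [<-|neq] := eqVneq i j; first by rewrite /swing; case: (b i); lia.
  have na : a i <> a j by move=> /(ai _ _ iN jN) /eqP; rewrite (negPf neq).
  by move: (ar _ iN) (ar _ jN); rewrite /swing; case: (b i); case: (b j); lia.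
Qed.

(* Around the cycle the zigzag [1, N, 2, N-1, ...] with alternating signs has the successive
   sums [N-1, N-2, ..., 1]; reversing the signs from the odd position [p] on replaces
   [N-p] by [N] there, and [N-p] reappears as the sum of the two ends. *)
Lemma cyclic_heffter3 (N : nat) : 4 <= N -> N = 0 %[mod 4] \/ N = 1 %[mod 4] ->
  exists f, cyclic_heffter N 3 f.
Proof.
move=> N4 Nmod.
(* The two ends of the zigzag give the magnitude [N/2 + 1] for even [N] and [(N - 1)/2] for odd [N].
   Equating it with [N - p] determines [p], which is odd exactly when [N] is 0 or 1 modulo 4. *)
have [p [podd p0 pN pE]] : exists p, [/\ odd p, 0 < p, p < N &
    if odd N then N = p.*2.-1 else N = p.*2.+2].
  case: Nmod => Nmod.
    by exists (N./2.-1); split; [| | |case: ifP]; lia.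
  by exists (N./2.+1); split; [| | |case: ifP]; lia.
pose b i := odd i == (p <= i).
pose dl i := if i == 0 then N - p else if i == p then N else N - i.
have T := swing_transversal b (@zigzag_range N) (@zigzag_inj N).
eexists; apply: (cyclic_heffter3_of (dl := dl)) T _ _ _; first by lia.
- move=> i iN; rewrite /dl /b; case: (posnP i) => [->|i0].
    have -> : cyc_sub N 0 1 = N.-1 by rewrite /cyc_sub /=; lia.
    have -> : p <= N.-1 by lia.
    have -> : p <= 0 = false by lia.
    rewrite /swing /zigzag; move: pE; case: (boolP (odd N)) => oN.
      have -> : odd N.-1 = false by lia.
      by rewrite /=; lia.
    have -> : odd N.-1 by lia.
    by rewrite /=; lia.
  have -> : cyc_sub N i 1 = i.-1 by rewrite /cyc_sub; case: ifP; lia.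
  rewrite /swing /zigzag.
  have -> : odd i.-1 = ~~ odd i by lia.
  have -> : i.-1./2 = if odd i then i./2 else i./2.-1 by case: ifP; lia.
  have -> : (p <= i.-1) = (p < i) by lia.
  case: (ltngtP i p) => [||ip]; case: (boolP (odd i)) => oi /=; lia.
- by move=> i iN; rewrite /dl; case: eqP => ?; [|case: eqP => ?]; lia.
- by move=> i j iN jN; rewrite /dl; do ?case: ifP => ?; lia.
Qed.

(* The conditional is the sum of two neighbours in the sequence [v = 1, -1, 3, -3, ..] of
   [cyclic_heffter5]. *)
Lemma zigzag_sum5 (N j : nat) (h := N./2) (b := fun j => odd j == (2 <= j <= h.+1))
    (w := fun j => swing (b j) (zigzag N j)) :
  7 <= N -> N = 3 %[mod 4] -> j < N ->
  `|(2 - w j - w (cyc_sub N j 1) -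
      (if j == 2 then N.+1 else if 2 < j <= h.+2 then 2 else 0)%N%:Z)%R|%N =
  if j == 2 then 1 else if j == h.+2 then N.-1 else if j == 0 then h
  else if j == 1 then N else N.+1 - j.
Proof.
move=> N7 Nmod jN.
case: (posnP j) => [->|j0].
  have -> : cyc_sub N 0 1 = N.-1 by rewrite /cyc_sub /=; lia.
  rewrite /w /b /swing /zigzag /=.
  have -> : N.-1 <= h.+1 = false by rewrite /h; lia.
  have -> : odd N.-1 = false by lia.
  by rewrite andbF /= /h; lia.
have -> : cyc_sub N j 1 = j.-1 by rewrite /cyc_sub; case: ifP; lia.
rewrite /w /b /swing /zigzag.
have -> : odd j.-1 = ~~ odd j by lia.
have -> : (1 < j.-1 <= h.+1) = (2 < j <= h.+2) by lia.
have -> : (1 < j <= h.+1) = (1 < j < h.+2) by lia.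
have [h1 h2] : 1 < h.+2 /\ 2 < h.+2 by rewrite /h; lia.
case: (ltngtP j 2) => [j2|j2|->]; last first.
- by rewrite h1 h2 /=; lia.
- case: (ltngtP j h.+2) => jh /=; case: (boolP (odd j)) => oj /=; move: jh; rewrite /h;
    do ?case: eqP => ?; lia.
- have -> : j = 1 by lia.
  by rewrite /=; lia.
Qed.

(* Position [jj i] is that of row [i] on the tour [.., 0, 2, 4, ..] of all rows, which makes
   the neighbours at distance 2 consecutive. The sequence [v = 1, -1, 3, -3, ..] contributes
   a constant +1 or -1 to the sums of the zigzag on either half of the tour, raising their
   absolute values by 1, and [N] at one place; the tour is started so that this place is the
   first sign reversal of the zigzag. *)
Lemma cyclic_heffter5 (N : nat) : 7 <= N -> N = 3 %[mod 4] -> exists f, cyclic_heffter N 5 f.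
Proof.
move=> N7 Nmod; pose h := N./2.
pose b j := odd j == (2 <= j <= h.+1).
pose jj i := if odd i then cyc_add N (h + 3) i./2 else i./2 + 2.
(* The values [N + 1 - j] for [j >= 3] run through [2 .. N - 2]; at [j = h + 2] the value [h] gives
   way to [N - 1] and reappears at [j = 0], while [j = 1, 2] supply [N] and 1. *)
pose dl j := if j == 2 then 1 else if j == h.+2 then N.-1 else if j == 0 then h
  else if j == 1 then N else N.+1 - j.
have NE : N = h.*2.+1 by rewrite /h; lia.
have oh : odd h by rewrite /h; lia.
have jjN i : i < N -> jj i < N.
  by move=> iN; rewrite /jj /cyc_add; case: ifP => oi; first case: ifP; lia.
have jjI i j : i < N -> j < N -> jj i = jj j -> i = j.
  by move=> iN jN; rewrite /jj /cyc_add; case: ifP => oi; case: ifP => oj;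
     do ?case: ifP => ?; lia.
have Tw : pair_transversal N (fun i => swing (b (jj i)) (zigzag N (jj i))).
  apply: (@swing_transversal N (fun i => b (jj i)) (fun i => zigzag N (jj i))) => [i iN|i j iN jN].
    exact/zigzag_range/jjN.
  by move/zigzag_inj => E; apply: jjI => //; apply: E; apply: jjN.
have Tv : pair_transversal N (fun i => swing (~~ odd i) i.+1).
  by apply: (@swing_transversal N (fun i => ~~ odd i) S) => [i|i j _ _ []].
eexists; apply: (cyclic_heffter5_of (dl := fun i => dl (jj i)) _ Tw Tv); first by lia.
- move=> i iN.
  have -> : jj (cyc_sub N i 2) = cyc_sub N (jj i) 1.
    rewrite /jj [cyc_sub N i 2]/cyc_sub /cyc_add; case: (leqP 2 i) => i2.
      have -> : odd (i - 2) = odd i by lia.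
      by case: ifP => oi; do ?case: ifP => ?; rewrite /cyc_sub; case: ifP => ?; lia.
    have -> : odd (i + N - 2) = ~~ odd i by lia.
    by case: ifP => oi; do ?case: ifP => ?; rewrite /cyc_sub; case: ifP => ?; lia.
  rewrite /dl -(zigzag_sum5 N7 Nmod (jjN _ iN)); congr `|_|; rewrite -/h -/(b _) -/(b _).
  rewrite -addrA -opprD; congr (_ - _)%R.
  rewrite /swing /jj /cyc_add /cyc_sub; case: (posnP i) => [->|i0].
    have -> : odd (0 + N - 1) = false by lia.
    by rewrite /=; lia.
  have -> : odd (i - 1) = ~~ odd i by lia.
  by case: (boolP (odd i)) => oi /=; first case: (ltnP (h + 3 + i./2) N) => ?;
    case: eqP => ?; do ?case: ifP => ?; lia.
- by move=> i /jjN; rewrite /dl; do ?case: eqP => ?; lia.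
- move=> i j iN jN E; apply: jjI => //; move: (jjN _ iN) (jjN _ jN) E; rewrite /dl.
  by move: (jj i) (jj j) => x y; do ?case: ifP => ?; lia.
Qed.

(** * Strips of blocks *)

Definition signed (b : bool) (x : nat) : int := if b then Posz x else (- Posz x)%R.

Lemma signedD b x y : signed b (x + y) = (signed b x + signed b y)%R.
Proof. by case: b => /=; lia. Qed.

Lemma signedM b x y : signed b (x * y) = (signed b x * Posz y)%R.
Proof. by case: b => /=; lia. Qed.

Lemma abs_signed b x : `|signed b x|%N = x.
Proof. by case: b => /=; lia. Qed.

(* A [2 x 2e] array whose [t]-th [2 x 2] block has the entry [ps t j i], [mg t j i] (sign
   and magnitude) in row [i] and column [j]. Having as many positive as negative
   entries in each row and column, it keeps its row and column sums when all
   magnitudes are shifted by a constant. *)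
Record strip (e : nat) (ps : nat -> bool -> bool -> bool) (mg : nat -> bool -> bool -> nat)
  : Prop := Strip {
  strip_range : forall t j i, t < e -> 1 <= mg t j i <= 4 * e;
  strip_inj : forall t j i t' j' i', t < e -> t' < e ->
    mg t j i = mg t' j' i' -> [/\ t = t', j = j' & i = i'];
  strip_sign : forall t j, t < e -> ps t j true = ~~ ps t j false;
  strip_row_sign : forall i,
    (\sum_(t < e) (signed (ps t false i) 1 + signed (ps t true i) 1) = 0)%R;
  strip_row_sum : forall i,
    (\sum_(t < e) (signed (ps t false i) (mg t false i) +
                   signed (ps t true i) (mg t true i)) = 0)%R
}.

Definition strip_col (ps : nat -> bool -> bool -> bool) (mg : nat -> bool -> bool -> nat)
    (t : nat) (j : bool) : int :=
  (signed (ps t j false) (mg t j false) + signed (ps t j true) (mg t j true))%R.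

(** Strip [p] gets the sign of [sg p] and its magnitudes are shifted by [4 * e] times the rank of
    [p], so the strips share out [1 .. n * k]. Balanced signs cancel the shift in rows and in block
    columns; hence only the unshifted column sums have to be checked. [g] and [h] tag cells as in
    [heffter_of_labels]. *)
Lemma heffter_of_strips (P G H : finType) (m n s k e : nat)
    (ps : nat -> bool -> bool -> bool) (mg : nat -> bool -> bool -> nat)
    (sg : P -> bool) (r : P -> bool -> 'I_m) (c : P -> 'I_e -> bool -> 'I_n)
    (g : P -> bool -> 'I_e -> bool -> G) (h : P -> bool -> 'I_e -> bool -> H) :
  strip e ps mg ->
  #|G| = s -> #|H| = k -> #|P| * (4 * e) = n * k -> m * s = n * k ->
  (forall p i t j p' i' t' j', r p i = r p' i' -> g p i t j = g p' i' t' j' ->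
     [/\ p = p', i = i', t = t' & j = j']) ->
  (forall p i t j p' i' t' j', c p t j = c p' t' j' -> h p i t j = h p' i' t' j' ->
     [/\ p = p', i = i', t = t' & j = j']) ->
  (forall p i t j p' i' t' j', r p i = r p' i' -> c p t j = c p' t' j' ->
     [/\ p = p', i = i', t = t' & j = j']) ->
  (forall y, \sum_(x : P * ('I_e * bool) | c x.1 x.2.1 x.2.2 == y)
     (-1) ^+ sg x.1 * strip_col ps mg x.2.1 x.2.2 = 0)%R ->
  exists A : pf_array m n, integer_heffter s k A.
Proof.
move=> [rng inj sgn rsgn rsum] cardG cardH cardP ms injr injc injrc cols.
pose L := ((P * bool) * ('I_e * bool))%type.
pose off (p : P) := 4 * e * enum_rank p.
pose v (l : L) := let: ((p, i), (t, j)) := l in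
  ((-1) ^+ sg p * signed (ps t j i) (mg t j i + off p))%R.
have absv l : `|v l|%N = mg l.2.1 l.2.2 l.1.2 + off l.1.1.
  by move: l => [[p i] [t j]] /=; case: (sg p) => /=; rewrite ?mulN1r ?mul1r ?abszN abs_signed.
have cardL : #|{: L}| = n * k.
  by rewrite !card_prod card_ord card_bool -cardP; lia.
pose rL (l : L) := r l.1.1 l.1.2.
pose cL (l : L) := c l.1.1 l.2.1 l.2.2.
apply: (@heffter_of_labels L G H m n s k rL cL v
   (fun l => g l.1.1 l.1.2 l.2.1 l.2.2) (fun l => h l.1.1 l.1.2 l.2.1 l.2.2)) => //.
- by move=> [[p i] [t j]] [[p' i'] [t' j']] /= [] /injr /[apply] -[] /= -> -> -> ->.
- by move=> [[p i] [t j]] [[p' i'] [t' j']] /= [] /injc /[apply] -[] /= -> -> -> ->.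
- by move=> [[p i] [t j]] [[p' i'] [t' j']] /= [] /injrc /[apply] -[] /= -> -> -> ->.
- move=> [[p i] [t j]] [[p' i'] [t' j']]; rewrite !absv /= => E.
  have R1 := rng t j i (ltn_ord t); have R2 := rng t' j' i' (ltn_ord t').
  have Ep : enum_rank p = enum_rank p' :> nat by move: E; rewrite /off; nia.
  have [|et -> ->] := inj t j i t' j' i' (ltn_ord t) (ltn_ord t').
    by move: E; rewrite /off Ep; lia.
  by congr (_, _, (_, _)); [apply/enum_rank_inj/val_inj | apply/val_inj].
- move=> [[p i] [t j]]; rewrite absv /= -cardP.
  have R1 := rng t j i (ltn_ord t); rewrite /off.
  have : 4 * e * (enum_rank p).+1 <= 4 * e * #|P| by rewrite leq_mul2l ltn_ord orbT.
  by rewrite mulnS [#|P| * _]mulnC; lia.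
- move=> y; transitivity (\sum_(x : P * bool | r x.1 x.2 == y) \sum_(z : 'I_e * bool) v (x, z))%R.
    by rewrite pair_big_dep; apply: eq_big => [[x z]|[x z] _]; rewrite ?andbT.
  apply: big1 => -[p i] _.
  transitivity (\sum_(t < e) \sum_(j : bool) v (p, i, (t, j)))%R.
    by rewrite pair_bigA; apply: eq_bigr => -[].
  transitivity ((-1) ^+ sg p *
    (\sum_(t < e) (signed (ps t false i) (mg t false i) + signed (ps t true i) (mg t true i)) +
     (\sum_(t < e) (signed (ps t false i) 1 + signed (ps t true i) 1)) * Posz (off p)))%R.
    rewrite mulr_suml -big_split mulr_sumr; apply: eq_bigr => t _ /=.
    rewrite big_bool /= !signedD -[off p]mul1n !signedM mul1n; ring.
  by rewrite rsgn rsum mul0r addr0 mulr0.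
- move=> y; rewrite -[RHS](cols y).
  transitivity (\sum_(x : P * ('I_e * bool) | c x.1 x.2.1 x.2.2 == y)
                 \sum_(i : bool) v (x.1, i, x.2))%R; last first.
    apply: eq_bigr => -[p [t j]] _; rewrite big_bool /= /strip_col sgn //.
    by rewrite !signedD; case: (ps t j false) => /=; ring.
  rewrite pair_big_dep /=.
  rewrite (reindex (fun x : (P * ('I_e * bool)) * bool => (x.1.1, x.2, x.1.2))) /=.
    by apply: eq_bigl => -[[p [t j]] i]; rewrite andbT.
  by exists (fun l : L => (l.1.1, l.2, l.1.2)) => [[[p tj] i]|[[p i] tj]].
Qed.

(* Two more blocks, [(4e + 1, -(4e + 2)), (-(4e + 3), 4e + 4)] and
   [(-(4e + 5), 4e + 6), (4e + 7, -(4e + 8))] as pairs of columns, with column sums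
   [-1, 1, 1, -1]. *)
Definition extend_sign (e : nat) (ps : nat -> bool -> bool -> bool) (t : nat) (j i : bool) :=
  if t < e then ps t j i else (t == e.+1) (+) ~~ j (+) i.

Definition extend_mag (e : nat) (mg : nat -> bool -> bool -> nat) (t : nat) (j i : bool) :=
  if t < e then mg t j i else 4 * t + 2 * j + i + 1.

Lemma strip_extend (e : nat) (ps : nat -> bool -> bool -> bool) (mg : nat -> bool -> bool -> nat) :
  strip e ps mg -> strip e.+2 (extend_sign e ps) (extend_mag e mg).
Proof.
move=> [rng inj sgn rsgn rsum]; split.
- move=> t j i te; rewrite /extend_mag; case: ifP => [/(rng t j i)|]; first by lia.
  by case: j; case: i; lia.
- move=> t j i t' j' i' te te'; rewrite /extend_mag; case: ifP => lt; case: ifP => lt'.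
  + exact: inj.
  + by have := rng t j i lt; lia.
  + by have := rng t' j' i' lt'; lia.
  + by case: j; case: i; case: j'; case: i' => /= E; split=> //; lia.
- move=> t j te; rewrite /extend_sign; case: ifP => [|_]; first exact: sgn.
  by rewrite addbT addbF.
- move=> i; rewrite !big_ord_recr /= -[RHS]addr0 -[RHS]addr0; congr (_ + _ + _)%R.
  + rewrite -[RHS](rsgn i); apply: eq_bigr => t _.
    by rewrite /extend_sign ltn_ord.
  + by rewrite /extend_sign ltnn ltn_eqF //; case: i.
  + by rewrite /extend_sign ltnNge leqnSn eqxx; case: i.
- move=> i; rewrite !big_ord_recr /= -addrA.
  rewrite (eq_bigr (fun t : 'I_e => signed (ps t false i) (mg t false i) +
      signed (ps t true i) (mg t true i)))%R => [|t _]; last first.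
    by rewrite /extend_sign /extend_mag ltn_ord.
  rewrite rsum add0r /extend_sign /extend_mag ltnn (ltnNge e.+1) leqnSn eqxx /= ltn_eqF //.
  by case: i => /=; lia.
Qed.

Lemma extend_col_lt (e : nat) ps mg (t : nat) (j : bool) : t < e ->
  strip_col (extend_sign e ps) (extend_mag e mg) t j = strip_col ps mg t j.
Proof. by move=> te; rewrite /strip_col /extend_sign /extend_mag te. Qed.

Lemma extend_col_ge (e : nat) ps mg (t : nat) (j : bool) : e <= t < e.+2 ->
  strip_col (extend_sign e ps) (extend_mag e mg) t j = (if (t == e) == j then 1 else -1)%R.
Proof.
move=> te; rewrite /strip_col /extend_sign /extend_mag ltnNge; have -> : e <= t by lia.
have -> : (t == e.+1) = (t != e) by lia.
by case: (t == e); case: j => /=; lia.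
Qed.

(** Strips written out as lists over the columns [2 * t + j]; each bottom sign is opposite to the
    top one. *)
Definition tile_sign (tops : seq bool) (t : nat) (j i : bool) : bool :=
  nth false tops (2 * t + j) (+) i.

Definition tile_mag (top bottom : seq nat) (t : nat) (j i : bool) : nat :=
  nth 0 (if i then bottom else top) (2 * t + j).

(** The two blocks of an extension have left column sums -1, 1 and right ones 1, -1, so balance is
    preserved. The start, for three blocks, has column sums -1, 1, 2, -5, -1, 4. *)
Lemma balanced_strip (e : nat) : odd e -> 3 <= e -> exists ps mg,
  strip e ps mg /\ forall j, (\sum_(t < e) strip_col ps mg t j = 0)%R.
Proof.
move=> oe e3; have [q ->] : exists q, e = 3 + q * 2 by exists (e - 3)./2; lia.
elim: q => [|q IH] {e oe e3}.
  exists (tile_sign [:: true; false; false; true; true; false]).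
  exists (tile_mag [:: 1; 3; 5; 6; 9; 8] [:: 2; 4; 7; 11; 10; 12]).
  split; last by case; rewrite !big_ord_recr big_ord0.
  split.
  - by move=> [|[|[|t]]] [] [].
  - by move=> [|[|[|t]]] [] [] [|[|[|t']]] [] [].
  - by move=> [|[|[|t]]] [].
  - by case; rewrite !big_ord_recr big_ord0.
  - by case; rewrite !big_ord_recr big_ord0.
have [ps [mg [S bal]]] := IH.
exists (extend_sign (3 + q * 2) ps), (extend_mag (3 + q * 2) mg).
have -> : 3 + q.+1 * 2 = (3 + q * 2).+2 by lia.
split; first exact: strip_extend.
move=> j; rewrite 2!big_ord_recr /= !extend_col_ge ?leqnn ?leqnSn ?ltnSn ?leqW //.
rewrite (eq_bigr (fun t : 'I_(3 + q * 2) => strip_col ps mg t j)) => [|t _]; last first.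
  exact: extend_col_lt.
by rewrite bal eqxx gtn_eqF //; case: j.
Qed.

(** Each added block is itself antisymmetric. The start has column sums -1, 1, 2, -2, 2, -2. *)
Lemma antisymmetric_strip (e : nat) : odd e -> 3 <= e -> exists ps mg,
  strip e ps mg /\ forall t, t < e -> (strip_col ps mg t true = - strip_col ps mg t false)%R.
Proof.
move=> oe e3; have [q ->] : exists q, e = 3 + q * 2 by exists (e - 3)./2; lia.
elim: q => [|q IH] {e oe e3}.
  exists (tile_sign [:: true; false; false; true; false; true]).
  exists (tile_mag [:: 1; 3; 5; 6; 9; 10] [:: 2; 4; 7; 8; 11; 12]).
  split; last by move=> [|[|[|t]]].
  split.
  - by move=> [|[|[|t]]] [] [].
  - by move=> [|[|[|t]]] [] [] [|[|[|t']]] [] [].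
  - by move=> [|[|[|t]]] [].
  - by case; rewrite !big_ord_recr big_ord0.
  - by case; rewrite !big_ord_recr big_ord0.
have [ps [mg [S anti]]] := IH.
exists (extend_sign (3 + q * 2) ps), (extend_mag (3 + q * 2) mg).
have -> : 3 + q.+1 * 2 = (3 + q * 2).+2 by lia.
split; first exact: strip_extend.
move=> t tlt; case: (ltnP t (3 + q * 2)) => te; first by rewrite !extend_col_lt // anti.
by rewrite !extend_col_ge ?te //; case: (t == _).
Qed.

(** * Placing the strips in the rectangle *)

Definition ord_add N (i : 'I_N) (t : nat) : 'I_N := insubd i (cyc_add N i t).

(** The bound on [t] rules out the default value of [insubd]. *)
Lemma val_ord_add N (i : 'I_N) t : t <= N -> ord_add i t = cyc_add N i t :> nat.
Proof. by move=> tN; rewrite val_insubd cyc_add_lt. Qed.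

Lemma ord_add_inj N t : t <= N -> injective (fun i : 'I_N => ord_add i t).
Proof.
move=> tN i j /(congr1 (@nat_of_ord N)); rewrite !val_ord_add // => /cyc_add_inj E.
exact/val_inj/E.
Qed.

Lemma eq_add_mul (c x y x' y' : nat) :
  x < c -> x' < c -> x + c * y = x' + c * y' -> x = x' /\ y = y'.
Proof.
move=> xc xc' E; have c0 : 0 < c by case: (c) xc.
have ex : x = x'.
  by move: (congr1 (modn^~ c) E); rewrite ![c * _]mulnC ![_ + _ * c]addnC !modnMDl !modn_small.
by split=> //; move: E; rewrite ex => /addnI /eqP; rewrite eqn_pmul2l // => /eqP.
Qed.

Lemma sum_alternating (V : zmodType) (F : V) (m q : nat) :
  (\sum_(m <= i < m + q.*2) (if odd i then - F else F) = 0)%R.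
Proof.
elim: q => [|q IH]; first by rewrite addn0 big_geq.
have -> : m + q.+1.*2 = (m + q.*2).+2 by lia.
rewrite !big_nat_recr //=; try lia.
by rewrite IH add0r; case: (odd _) => /=; rewrite ?addNr ?subrr.
Qed.

(** Both sides lie between 0 and [2 * e <= c], so only 0 and [c = 2 * e] could be confused; in that
    case [i = i'] cancels and what remains is below [c]. *)
Lemma block_offset_inj (e c t t' : nat) (i i' j j' : bool) :
  t < e -> t' < e -> 2 * e <= c -> (2 * e = c -> i = i') ->
  2 * t + j + i' = 2 * t' + j' + i %[mod c] -> 2 * t + j + i' = 2 * t' + j' + i.
Proof.
move=> te te' ec ii E.
have [cE | cne] := eqVneq (2 * e) c; last first.
  apply: eq_mod_small E; move: te te' ec cne; clear -j j' i i';
  by case: j; case: j'; case: i; case: i'; lia.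
move: E; rewrite -ii // => /eqP; rewrite eqn_modDr => /eqP E; congr (_ + _).
by apply: eq_mod_small E; move: te te' ec; clear -j j'; case: j; case: j'; lia.
Qed.

(* The strips fill [e] consecutive diagonals of [2 x 2] blocks of the square of order [N]. *)
Lemma heffter_even_gt2 (c a b e : nat) :
  coprime a b -> 0 < a -> 0 < b -> odd e -> 3 <= e -> 2 * e <= c -> ~~ odd (c * a * b) ->
  exists A : pf_array (c * a) (c * b), integer_heffter (2 * e * b) (2 * e * a) A.
Proof.
move=> cop a0 b0 oe e3 ec evN.
have [ps [mg [S bal]]] := balanced_strip oe e3.
set N := c * a * b in evN; pose w := N./2.
have NE : N = 2 * w by rewrite /w; lia.
have c0 : 0 < c by lia.
have m0 : 0 < c * a by rewrite muln_gt0 c0.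
have n0 : 0 < c * b by rewrite muln_gt0 c0.
have cN : c <= N by rewrite /N -mulnA leq_pmulr // muln_gt0 a0.
have nN : c * b %| N by rewrite /N mulnAC dvdn_mulr.
have NE1 : N = b * (c * a) by rewrite /N mulnC.
have NE2 : N = a * (c * b) by rewrite /N; lia.
have ew (t : 'I_e) : t <= w by have := ltn_ord t; lia.
pose row (p : 'I_w) (i : bool) := 2 * p + i.
pose col (p : 'I_w) (t : 'I_e) (j : bool) := 2 * ord_add p t + j.
have rowN p i : row p i < N by rewrite /row; have := ltn_ord p; case: i; lia.
have colN p t j : col p t j < N by rewrite /col; have := ltn_ord (ord_add p t); case: j; lia.
have rP p i : row p i %% (c * a) < c * a by rewrite ltn_mod.
have cP p t j : col p t j %% (c * b) < c * b by rewrite ltn_mod.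
have gP p i : row p i %/ (c * a) < b by rewrite ltn_divLR // -NE1.
have hP p t j : col p t j %/ (c * b) < a by rewrite ltn_divLR // -NE2.
have row_inj p i p' i' : row p i = row p' i' -> p = p' /\ i = i'.
  by rewrite /row => E; split; [apply/val_inj; move: E => /= | move: E]; case: i; case: i' => //; lia.
have col_inj p t j p' j' : col p t j = col p' t j' -> p = p' /\ j = j'.
  rewrite /col => E; have E2 : ord_add p t = ord_add p' t /\ j = j'.
    by split; [apply/val_inj; move: E => /= | move: E]; case: j; case: j' => //; lia.
  by split; [apply: (ord_add_inj (ew t)) | ]; case: E2.
apply: (@heffter_of_strips 'I_w ('I_b * ('I_e * bool))%type ('I_a * ('I_e * bool))%type
  _ _ _ _ e ps mg (fun _ => false)
  (fun p i => Ordinal (rP p i)) (fun p t j => Ordinal (cP p t j))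
  (fun p i t j => (Ordinal (gP p i), (t, j))) (fun p i t j => (Ordinal (hP p t j), (t, i)))) => //.
- by rewrite !card_prod !card_ord card_bool; lia.
- by rewrite !card_prod !card_ord card_bool; lia.
- rewrite card_ord; have -> : c * b * (2 * e * a) = 2 * e * (a * (c * b)) by lia.
  by rewrite -NE2 [N]NE; lia.
- by lia.
- move=> p i t j p' i' t' j' [e1] [e2 -> ->].
  by have [-> ->] := row_inj _ _ _ _ (eq_divn_modn e2 e1).
- move=> p i t j p' i' t' j' [e1] [e2 et ->]; rewrite -et in e1 e2 *.
  by have [-> ->] := col_inj _ _ _ _ _ (eq_divn_modn e2 e1).
- move=> p i t j p' i' t' j' [e1] [e2].
  have colE q x y : col q x y = 2 * q + (2 * x + y) %[mod c * b].
    have xw := ew x; rewrite /col val_ord_add // /cyc_add.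
    case: ltnP => ?; first by congr (_ %% _); lia.
    have -> : 2 * q + (2 * x + y) = N + (2 * (q + x - w) + y) by lia.
    by case/dvdnP: nN => z ->; rewrite modnMDl.
  (* Column minus row is [2 * t + j - i]; adding [i + i'] to both sides avoids subtraction. *)
  have {e2} E2 : row p i + (2 * t + j + i') = row p' i' + (2 * t' + j' + i) %[mod c * b].
    have -> : row p i + (2 * t + j + i') = 2 * p + (2 * t + j) + (i + i') by rewrite /row; lia.
    have -> : row p' i' + (2 * t' + j' + i) = 2 * p' + (2 * t' + j') + (i + i') by rewrite /row; lia.
    by apply/eqP; rewrite eqn_modDr -!colE; apply/eqP.
  have E1c : row p i = row p' i' %[mod c].
    by rewrite -(modn_dvdm (row p i) (dvdn_mulr a (dvdnn c))) e1 modn_dvdm ?dvdn_mulr.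
  have E2c : 2 * t + j + i' = 2 * t' + j' + i %[mod c].
    have E : row p i + (2 * t + j + i') = row p' i' + (2 * t' + j' + i) %[mod c].
      by rewrite -(modn_dvdm (_ + _) (dvdn_mulr b (dvdnn c))) E2 modn_dvdm ?dvdn_mulr.
    by apply/eqP; rewrite -(eqn_modDl (row p i)) E -modnDml -E1c modnDml.
  have Ed : 2 * t + j + i' = 2 * t' + j' + i.
    apply: block_offset_inj ec _ E2c => // cE.
    (* Here [c] is even, so the residue of the row modulo [c] determines its parity, which is
       [i]. *)
    have : odd (row p i %% c) = odd (row p' i' %% c) by rewrite E1c.
    have oc : odd c = false by rewrite -cE oddM.
    by rewrite !odd_mod // /row !mul2n !oddD !odd_double !oddb.
  have Er : row p i = row p' i'.
    apply: (eq_mod_coprime_mul cop (rowN _ _) (rowN _ _) e1).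
    by apply/eqP; rewrite -(eqn_modDr (2 * t + j + i')) E2 Ed.
  have [-> ii] := row_inj _ _ _ _ Er; rewrite -ii in Ed *.
  have [tt jj] : t = t' :> nat /\ j = j'.
    by move: Ed; clear -j j' i i'; case: j; case: j'; case: i => /= Ed; split=> //; lia.
  by split=> //; apply/val_inj.
- move=> y; transitivity (\sum_(j : bool) \sum_(t < e)
      \sum_(p < w | Ordinal (cP p t j) == y) strip_col ps mg t j)%R.
    rewrite pair_bigA /= (reindex (fun x : 'I_e * bool => (x.2, x.1))) /=; last first.
      by exists (fun x => (x.2, x.1)) => [[]|[]].
    rewrite (exchange_big_dep xpredT) //= pair_big_dep /=.
    by apply: eq_big => [[p [t j]]|[p [t j]] _] //=; rewrite mul1r.
  apply: big1 => j _.
  (* Reindexing by the block column [q] makes the condition independent of [t]; every [q] then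
     receives all blocks of a balanced strip. *)
  pose cl (q : 'I_w) := (2 * q + j) %% (c * b) == y.
  rewrite (eq_bigr (fun t : 'I_e => \sum_(q < w | cl q) strip_col ps mg t j))%R => [|t _].
    by rewrite exchange_big big1.
  by rewrite [RHS](reindex_inj (ord_add_inj (ew t))).
Qed.

Lemma add_mul_lt (c x y z : nat) : x < c -> y < z -> x + c * y < c * z.
Proof.
move=> xc yz; apply: leq_trans (_ : c * y.+1 <= _); first by rewrite mulnS ltn_add2r.
by rewrite leq_mul2l yz orbT.
Qed.

(* Each strip lies in columns of two consecutive residues modulo [c], so by antisymmetry
   the left column sum of one strip cancels the right column sum of the previous one. *)
Lemma heffter_gcd2_even (c a b : nat) :
  2 <= c -> 0 < a -> odd b -> 3 <= b ->
  exists A : pf_array (c * (2 * a)) (c * b), integer_heffter (2 * b) (2 * (2 * a)) A.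
Proof.
move=> c2 a0 ob b3.
have [ps [mg [S anti]]] := antisymmetric_strip ob b3.
have jc (j : bool) : j <= c by case: j; lia.
have rP (p : 'I_c * 'I_a) (i : bool) : p.1 + c * (2 * p.2 + i) < c * (2 * a).
  by apply: add_mul_lt => //; have := ltn_ord p.2; case: i; lia.
(* Both rows of strip [(u, x)] have residue [u] modulo [c]; the columns of its blocks have residues
   [u] and, cyclically, [u + 1], distinct because [2 <= c]. *)
have cP (p : 'I_c * 'I_a) (t : 'I_b) (j : bool) : ord_add p.1 j + c * t < c * b.
  exact: add_mul_lt.
apply: (@heffter_of_strips ('I_c * 'I_a)%type ('I_b * bool)%type ('I_a * (bool * bool))%type
  _ _ _ _ b ps mg (fun _ => false)
  (fun p i => Ordinal (rP p i)) (fun p t j => Ordinal (cP p t j))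
  (fun p i t j => (t, j)) (fun p i t j => (p.2, (i, j)))) => //.
- by rewrite card_prod card_ord card_bool; lia.
- by rewrite !card_prod card_ord card_bool; lia.
- by rewrite card_prod !card_ord; lia.
- by lia.
- move=> [u x] i t j [u' x'] i' t' j' [] /(eq_add_mul (ltn_ord _) (ltn_ord _)) /= [].
  move=> /val_inj -> E [-> ->].
  have [ex ->] : x = x' :> nat /\ i = i'.
    by move: E; clear; case: i; case: i' => E; split=> //; lia.
  by rewrite (val_inj ex).
- move=> [u x] i t j [u' x'] i' t' j' [] /(eq_add_mul (ltn_ord _) (ltn_ord _)) /= [].
  move=> /val_inj E /val_inj -> [-> -> ej].
  by move: E; rewrite ej => /(ord_add_inj (jc _)) ->.
- move=> [u x] i t j [u' x'] i' t' j' [] /(eq_add_mul (ltn_ord _) (ltn_ord _)) /= [/val_inj -> E]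
     [] /(eq_add_mul (ltn_ord _) (ltn_ord _)) /= [E2 /val_inj ->].
  have [ex ->] : x = x' :> nat /\ i = i'.
    by move: E; clear; case: i; case: i' => E; split=> //; lia.
  rewrite (val_inj ex); split=> //; move: E2; rewrite !val_ord_add // /cyc_add.
  by have uc := ltn_ord u'; case: (j); case: (j') => //=; do 2 case: ltnP => ?; lia.
- move=> y; transitivity (\sum_(x < a) \sum_(t < b) \sum_(j : bool)
      \sum_(u < c | Ordinal (cP (u, x) t j) == y) strip_col ps mg t j)%R.
    rewrite (eq_bigr (fun x : 'I_a => \sum_(z : 'I_b * bool)
      \sum_(u < c | Ordinal (cP (u, x) z.1 z.2) == y) strip_col ps mg z.1 z.2))%R; last first.
      by move=> x _; rewrite pair_bigA.
    rewrite pair_bigA /= (exchange_big_dep xpredT) //= pair_big_dep /=.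
    rewrite (reindex (fun x : ('I_c * 'I_a) * ('I_b * bool) => (x.1.1, (x.1.2, x.2)))) /=; last first.
      by exists (fun x => ((x.1, x.2.1), x.2.2)) => [[[]]|[? []]].
    by apply: eq_big => [[[u x] [t j]]|[[u x] [t j]] _] //=; rewrite mul1r.
  apply: big1 => x _; apply: big1 => t _.
  pose cl (u : 'I_c) := u + c * t == y.
  rewrite (eq_bigr (fun j : bool => \sum_(u < c | cl u) strip_col ps mg t j))%R => [|j _].
    by rewrite exchange_big big1 // => u _; rewrite big_bool anti //= addNr.
  by rewrite [RHS](reindex_inj (ord_add_inj (jc j))).
Qed.

(* For each residue, the first [b] strips form a Latin square of blocks and the remaining
   [a - b] strips cancel in pairs of opposite signs. *)
Lemma heffter_gcd2_odd (c a b : nat) :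
  0 < c -> odd a -> odd b -> 3 <= b <= a ->
  exists A : pf_array (2 * c * a) (2 * c * b), integer_heffter (2 * b) (2 * a) A.
Proof.
move=> c0 oa ob /andP[b3 ba].
have [ps [mg [S bal]]] := balanced_strip ob b3.
(* [sh x t] is the position of block [t] in strip [x]: cyclically shifted by [x] for the first [b]
   strips, unchanged afterwards. *)
pose sh (x t : nat) := if x < b then cyc_add b t x else t.
have shP (x : nat) (t : 'I_b) : sh x t < b.
  by rewrite /sh; case: ifP => // xb; apply: cyc_add_lt => //; apply: ltnW.
pose sho x t := Ordinal (shP x t).
have shI x (t t' : 'I_b) : sh x t = sh x t' -> t = t'.
  rewrite /sh; case: ifP => _ E; last exact: val_inj.
  by apply/val_inj/(cyc_add_inj (ltn_ord t) (ltn_ord t') E).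
have bit (u : 'I_c) (i : bool) : 2 * u + i < 2 * c by have := ltn_ord u; case: i; lia.
have bitI (u u' : 'I_c) (i i' : bool) : 2 * u + i = 2 * u' + i' -> u = u' /\ i = i'.
  move=> E; suff [eu ->] : u = u' :> nat /\ i = i' by split=> //; apply: val_inj.
  by move: E; clear; case: i; case: i' => E; split=> //; lia.
have rP (p : 'I_c * 'I_a) (i : bool) : 2 * p.1 + i + 2 * c * p.2 < 2 * c * a.
  exact: add_mul_lt.
have cP (p : 'I_c * 'I_a) (t : 'I_b) (j : bool) : 2 * p.1 + j + 2 * c * sho p.2 t < 2 * c * b.
  exact: add_mul_lt.
pose sg (x : nat) := (b <= x) && odd x.
apply: (@heffter_of_strips ('I_c * 'I_a)%type ('I_b * bool)%type ('I_a * bool)%type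
  _ _ _ _ b ps mg (fun p => sg p.2)
  (fun p i => Ordinal (rP p i)) (fun p t j => Ordinal (cP p t j))
  (fun p i t j => (t, j)) (fun p i t j => (p.2, i))) => //.
- by rewrite card_prod card_ord card_bool; lia.
- by rewrite !card_prod card_ord card_bool; lia.
- by rewrite card_prod !card_ord; lia.
- by lia.
- move=> [u x] i t j [u' x'] i' t' j' [] /(eq_add_mul (bit _ _) (bit _ _)) /= [].
  by move=> /bitI[-> ->] /val_inj -> [-> ->].
- move=> [u x] i t j [u' x'] i' t' j' [] /(eq_add_mul (bit _ _) (bit _ _)) /= [].
  by move=> /bitI[-> ->] E [ex ->]; rewrite ex in E *; rewrite (shI _ _ _ E).
- move=> [u x] i t j [u' x'] i' t' j' [] /(eq_add_mul (bit _ _) (bit _ _)) /= [].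
  move=> /bitI[-> ->] /val_inj -> [] /(eq_add_mul (bit _ _) (bit _ _)) /= [].
  by move=> /bitI[_ ->] E; rewrite (shI _ _ _ E).
- move=> y; transitivity (\sum_(u < c) \sum_(j : bool) \sum_(x < a)
      \sum_(t < b | Ordinal (cP (u, x) t j) == y) (-1) ^+ sg x * strip_col ps mg t j)%R.
    rewrite pair_bigA /= pair_bigA /= pair_big_dep /=.
    rewrite (reindex (fun x : ('I_c * bool * 'I_a) * 'I_b => ((x.1.1.1, x.1.2), (x.2, x.1.1.2)))) /=.
      by apply: eq_bigr.
    by exists (fun x => ((x.1.1, x.2.2), x.1.2, x.2.1)) => [[[[? ?] ?] ?]|[[? ?] [? ?]]].
  apply: big1 => u _; apply: big1 => j _.
  pose inv (x : nat) (t : 'I_b) : 'I_b := insubd t (if x < b then cyc_sub b t x else t).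
  have val_inv x (t : 'I_b) : inv x t = (if x < b then cyc_sub b t x else t) :> nat.
    by rewrite val_insubd; case: (ltnP x b) => xb; rewrite ?ltn_ord ?cyc_sub_lt // ltnW.
  have shK x : cancel (inv x) (sho x).
    move=> t; apply: val_inj; rewrite /= /sh val_inv; case: (ltnP x b) => // xb.
    by have := ltn_ord t; rewrite /cyc_sub; case: ifP => ?; rewrite /cyc_add; case: ifP => ?; lia.
  have invI x : injective (inv x) by apply: can_inj (shK x).
  pose cl (t : 'I_b) := 2 * u + j + 2 * c * t == y.
  rewrite (eq_bigr (fun x : 'I_a => \sum_(t < b | cl t)
      (-1) ^+ sg x * strip_col ps mg (inv x t) j))%R => [|x _]; last first.
    rewrite (reindex_inj (@invI x)); apply: eq_bigl => t.
    by rewrite -val_eqE /= -[sh x _]/(val (sho x (inv x t))) shK.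
  rewrite exchange_big big1 //= => t _.
  pose F (x : nat) : int := ((-1) ^+ sg x * strip_col ps mg (inv x t) j)%R.
  rewrite -(big_mkord xpredT F) (big_cat_nat (n := b)) //=.
  have -> : (\sum_(0 <= x < b) F x = 0)%R.
    rewrite big_mkord -[RHS](bal j).
    (* At a fixed position the first [b] strips show every block once, so their contribution is a
       column sum of the balanced strip. *)
    have cI : injective (fun x : 'I_b => inv x t).
      move=> x x' /(congr1 (@nat_of_ord b)); rewrite !val_inv !ltn_ord => E.
      apply: val_inj; move: E; have := ltn_ord x; have := ltn_ord x'; have := ltn_ord t.
      by rewrite /cyc_sub; case: ifP => ?; case: ifP => ?; rewrite /=; lia.
    rewrite [RHS](reindex_inj cI); apply: eq_bigr => x _.
    by rewrite /F /sg leqNgt ltn_ord /= mul1r.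
  rewrite add0r -[RHS](sum_alternating (strip_col ps mg t j) b (a - b)./2).
  have -> : b + (a - b)./2.*2 = a by lia.
  apply: eq_big_nat => x /andP[bx _].
  rewrite /F /sg bx /=; have -> : inv x t = t by apply: ord_inj; rewrite val_inv ltnNge bx.
  by case: (odd x); rewrite ?mulN1r ?mul1r.
Qed.

(** * Combining the constructions *)

Lemma heffter_transpose_exists (m n s k : nat) : m * s = n * k ->
  (exists A : pf_array m n, integer_heffter s k A) ->
  exists A : pf_array n m, integer_heffter k s A.
Proof. by move=> ms [A HA]; exists (A^T)%R; apply: heffter_transpose. Qed.

(** If [a] and [b] are both odd, [c] must be even, and transposition allows [b <= a]; otherwise
    exactly one of them is even, by coprimality, and transposition makes it [a]. *)
Lemma heffter_gcd2 (c a b : nat) :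
  coprime a b -> 1 < a -> 1 < b -> 1 < c -> ~~ odd (c * a * b) ->
  exists A : pf_array (c * a) (c * b), integer_heffter (2 * b) (2 * a) A.
Proof.
move=> cop a1 b1 c1 ev.
have even_a x y : 1 < x -> 1 < y -> ~~ odd x -> odd y ->
    exists A : pf_array (c * x) (c * y), integer_heffter (2 * y) (2 * x) A.
  move=> x1 y1 ex oy; have [w wE] : exists w, x = 2 * w by exists x./2; lia.
  by rewrite wE; apply: heffter_gcd2_even => //; lia.
have [oa | ea] := boolP (odd a); have [ob | eb] := boolP (odd b).
- have [w wE] : exists w, c = 2 * w.
    by exists c./2; move: ev; rewrite !oddM oa ob !andbT; lia.
  rewrite wE; have [ba | /ltnW ab] := leqP b a.
    by apply: heffter_gcd2_odd => //; lia.
  apply: heffter_transpose_exists; first by lia.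
  by apply: heffter_gcd2_odd => //; lia.
- by apply: heffter_transpose_exists; [lia | apply: even_a].
- exact: even_a.
- have : 2 %| gcdn a b by rewrite dvdn_gcd !dvdn2 ea eb.
  by rewrite (eqP cop).
Qed.

Theorem theorem1p4 (m n s k d : nat)
    (hs : 3 <= s <= n) (hk : 3 <= k <= m) (hms : m * s = n * k)
    (hd : d = gcdn s k)
    (hcases :
         d = 0 %[mod 4]
      \/ [/\ d = 1 %[mod 4], 5 <= d & n * k = 3 %[mod 4]]
      \/ (d = 2 %[mod 4] /\ n * k = 0 %[mod 4])
      \/ (d = 3 %[mod 4] /\
            (n * k = 0 %[mod 4] \/ n * k = 3 %[mod 4]))) :
  exists A : pf_array m n, integer_heffter s k A.
Proof.
have d0 : 0 < d by rewrite hd gcdn_gt0; lia.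
have [a kE] : exists a, k = d * a.
  by have /dvdnP[a ->] := dvdn_gcdr s k; exists a; rewrite -hd mulnC.
have [b sE] : exists b, s = d * b.
  by have /dvdnP[b ->] := dvdn_gcdl s k; exists b; rewrite -hd mulnC.
have cop : coprime a b.
  by move/eqP: hd; rewrite kE sE -muln_gcdr gcdnC -{1}[d]muln1 eqn_pmul2l // eq_sym.
have [a0 b0] : 0 < a /\ 0 < b by move: hs hk; rewrite kE sE; case: (a); case: (b); lia.
have mbna : m * b = n * a.
  by apply/eqP; rewrite -(eqn_pmul2l d0); apply/eqP; move: hms; rewrite kE sE; lia.
have /dvdnP[c mE] : a %| m by rewrite -(Gauss_dvdl _ cop) mbna dvdn_mull.
have nE : n = c * b by apply/eqP; rewrite -(eqn_pmul2r a0) -mbna mE; apply/eqP; lia.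
have dc : d <= c by rewrite -(leq_pmul2r b0) -sE -nE; case/andP: hs.
have nkE : n * k = c * a * b * d by rewrite nE kE; lia.
have cN : c <= c * a * b by rewrite -mulnA leq_pmulr // muln_gt0 a0.
(* A core of [e] diagonals grows by groups of four to [d] diagonals, which fit since [d <= c <= N],
   and is then folded. *)
have cyclic e f : d = e %[mod 4] -> e <= d -> cyclic_heffter (c * a * b) e f ->
    exists A : pf_array m n, integer_heffter s k A.
  move=> de ed F; have [|g G] := @cyclic_heffter_extend _ e d f _ ed (esym de) F.
    exact: leq_trans cN.
  by rewrite mE nE sE kE; apply: heffter_of_cyclic G; rewrite ?d0.
rewrite nkE in hcases.
case: hcases => [d4 | [[d4 d5 nk4] | [[d4 nk4] | [d4 nk4]]]].
- exact: cyclic d4 _ (cyclic_heffter0 _ (fun _ _ => 0%R)).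
- have [x dE] : exists x, d = 4 * x + 1 by exists (d %/ 4); lia.
  have N3 : c * a * b = 3 %[mod 4].
    by move: nk4; rewrite dE; move: (c * a * b) => N; rewrite mulnDr mulnCA; lia.
  have [|f F] := cyclic_heffter5 _ N3; first by move: N3; lia.
  exact: cyclic F.
- have [x dE] : exists x, d = 4 * x + 2 by exists (d %/ 4); lia.
  have evN : ~~ odd (c * a * b).
    by move: nk4; rewrite dE; move: (c * a * b) => N; rewrite mulnDr mulnCA; lia.
  rewrite mE nE sE kE; have [x0 | x_gt0] := posnP x; last first.
    have -> : d = 2 * (2 * x + 1) by lia.
    by apply: heffter_even_gt2 => //; lia.
  have d2 : d = 2 by lia.
  by rewrite d2; apply: heffter_gcd2 => //; move: hs hk dc; rewrite sE kE d2; lia.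
- have [x dE] : exists x, d = 4 * x + 3 by exists (d %/ 4); lia.
  (* Since [n * k = N * d] with [d] equal to -1 modulo 4, [N] is the negative of [n * k] modulo
     4. *)
  have N01 : c * a * b = 0 %[mod 4] \/ c * a * b = 1 %[mod 4].
    by move: nk4; rewrite dE; move: (c * a * b) => N; rewrite mulnDr mulnCA; lia.
  have [|f F] := cyclic_heffter3 _ N01; first by lia.
  by apply: cyclic F; lia.
Qed.
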